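(* Assume Hypothesis 0 and Assumption II (see context). Let $c(\cdot,\cdot)$ be the inner product on $\Sigma$, and let $d(\cdot,\cdot)$ be a bilinear form on $\Sigma$ that satisfies Property I (see context). Let $f_R\in R'$, $f_Y\in Y'$, and consider the primal problem (P): find $u\in V$ such that $$a_R(u,v)+b(u,Bv)+b(v,Bu)+a_Y(Bu,Bv)=\langle f_R,v\rangle+\langle f_Y,Bv\rangle\quad\forall v\in V.$$ (1) Problem (P) can be decoupled, in accordance with the five-field system (S5) of the context, into the following three problems, solved successively, the last of which delivers $u$: (a) find $r\in R$ such that $c(Br,Bv)=\langle f_R,v\rangle$ for all $v\in R$; (b) with $r$ solved out, find $(p,y,\xi)\in R\times Y\times\Sigma$ such that for all $(q,z,\eta)\in R\times Y\times\Sigma$: $a_Y(y,z)-d(\xi,z)=\langle f_Y,z\rangle+c(Br,z)$, $c(\xi,Bq)=0$, and $-d(y,\eta)+c(\eta,Bp)=0$; (c) with $y$ solved out, find $u\in R$ such that $c(Bu,Bs)=c(y,Bs)$ for all $s\in R$. (2) Problem (P) can be decoupled, in accordance with the system (S4) of the context, into the following three problems, solved successively, the last of which delivers $u$: (a') find $r\in R$ such that $c(Br,Bv)=\langle f_R,v\rangle$ for all $v\in R$; (b') with $r$ solved out, find $(y,\xi)\in Y\times\Sigma$ such that for all $(z,\eta)\in Y\times\Sigma$: $a_Y(y,z)-d(\xi,z)=\langle f_Y,z\rangle+c(Br,z)$ and $-d(y,\eta)=0$; (c') with $y$ solved out, find $u\in R$ such that $c(Bu,Bs)=c(y,Bs)$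 for all $s\in R$.
   Context: All spaces are real; $'$ denotes the dual space and $\langle\cdot,\cdot\rangle$ the duality pairing. Configurable triple: for Hilbert spaces $R,Y$ and an operator $B$, $\{R,Y,B\}$ is a configurable triple with ground space $H$ if $H$ is a Hilbert space, $Y\subset H$ continuously, and $B$ is a closed (linear) operator mapping $R$ into $H$. A Hilbert space $V$ is configurated by $\{R,Y,B\}$ if $V=\{w\in R: Bw\in Y\}$ and $\|w\|_V$ is equivalent to $\|w\|_R+\|Bw\|_Y$. The space $\Sigma:=BR+Y$ has norm $\|\sigma\|_\Sigma:=\inf\{\|Br\|_H+\|y\|_Y: r\in R,\ y\in Y,\ Br+y=\sigma\}$. Taken as known from earlier work: $\Sigma$ is a Hilbert space (up to an equivalent norm), $BR$ is closed in $\Sigma$, and $\|Br\|_H$ and $\|Br\|_\Sigma$ are equivalent for $r\in R$. The inner product $c(\cdot,\cdot)$ on $\Sigma$ induces a norm equivalent to $\|\cdot\|_\Sigma$; $(BR)^\perp$ is the orthogonal complement of $BR$ in $\Sigma$. For a subspace $S\subset\Sigma$, $S^0=\{g\in\Sigma':\langle g,\sigma\rangle=0\ \forall\sigma\in S\}$ is its polar set. Hypothesis 0: (i) $\{R,Y,B\}$ is a configurable triple and $V$ is configurated by it; (ii) $a(u,v):=a_R(u,v)+b(u,Bv)+b(v,Bu)+a_Y(Bu,Bv)$ is an inner product on $V$ (inducing a norm equivalent to $\|\cdot\|_V$), where $a_R$ and $a_Y$ are bounded symmetric semidefinite bilinear forms on $R$ and $Y$ respectively, and $b$ is a bounded bilinear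 form on $R\times Y$. Assumption II: $B$ is injective on $R$, $a_R(u,v)=0$ for all $u,v\in R$, and $b(v,z)=0$ for all $v\in R$, $z\in Y$. Property I of $d$: (i) $d$ is continuous on $\Sigma$ and $d(Bs,\tau)=0$ for all $s\in R$, $\tau\in\Sigma$; (ii) $\displaystyle\inf_{\tau\in(BR)^\perp}\sup_{\sigma\in(BR)^\perp}\frac{d(\tau,\sigma)}{\|\tau\|_\Sigma\|\sigma\|_\Sigma}\ge C>0$ (infimum and supremum over nonzero elements). System (S5): find $(p,u,y,\xi,r)\in R\times R\times Y\times\Sigma\times R$ such that for all $(q,v,z,\eta,s)\in R\times R\times Y\times\Sigma\times R$: $c(\xi,Bq)=0$; $a_R(u,v)+b(v,y)+c(Br,Bv)=\langle f_R,v\rangle$; $b(u,z)+a_Y(y,z)-d(\xi,z)-c(Br,z)=\langle f_Y,z\rangle$; $c(\eta,Bp)-d(\eta,y)=0$; $c(Bs,Bu)-c(Bs,y)=0$. System (S4): find $(u,y,g^0,g^0_\perp)\in R\times Y\times(BR)^0\times((BR)^\perp)^0$ such that for all $(v,z,l^0,l^0_\perp)\in R\times Y\times(BR)^0\times((BR)^\perp)^0$: $a_R(u,v)+b(v,y)+\langle g^0_\perp,Bv\rangle=\langle f_R,v\rangle$; $b(u,z)+a_Y(y,z)-\langle g^0,z\rangle-\langle g^0_\perp,z\rangle=\langle f_Y,z\rangle$; $-\langle l^0,y\rangle=0$; $\langle l^0_\perp,Bu\rangle-\langle l^0_\perp,y\rangle=0$.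
   Formalization: Property I is assumed for d and also for its transpose (automatic when d is symmetric); with Property I only as written, the claim fails, e.g. R=ℝ, Y=H=ℝ², Br=(r,0), d(t,s)=t₂(s₁+s₂), where (P) gives u=f_R+f₁ but (b),(c) give u=f_R+f₁−f₂. *)

(* Defs.v *)
From HB Require Import structures.
From mathcomp Require Import all_boot all_order all_algebra.
From mathcomp Require Import all_classical all_reals all_analysis.

Set Implicit Arguments.
Unset Strict Implicit.
Unset Printing Implicit Defensive.

Import Order.TTheory GRing.Theory Num.Theory.
Import numFieldNormedType.Exports.

Local Open Scope classical_set_scope.
Local Open Scope ring_scope.

HB.mixin Record CompleteNormedModule_isHilbert (K : realType) E
    & CompleteNormedModule K E := {
  hdot : {dot E for @idfun K};
  hdotE : forall x : E, hdot x x = `|x| ^+ 2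
}.

#[short(type="hilbertType")]
HB.structure Definition Hilbert (K : realType) :=
  {E of CompleteNormedModule K E & CompleteNormedModule_isHilbert K E}.

Definition norm_equiv (K : realType) (U : Type) (n1 n2 : U -> K) : Prop :=
  exists C1 C2 : K, [/\ 0 < C1, 0 < C2 &
    forall u, n1 u <= C1 * n2 u /\ n2 u <= C2 * n1 u].

Definition bounded_form (K : realType) (U W : normedModType K)
    (f : U -> W -> K) : Prop :=
  exists M : K, forall u w, `|f u w| <= M * `|u| * `|w|.

(* The inclusion of Y in H is carried by the injective map [emb]. The operator
   is defined on all of R, and closed means that its graph is closed. *)
Record configurable_triple (K : realType) (R Y H : hilbertType K) := {
  op : {linear R -> H};
  emb : {linear Y -> H};
  op_closed : closed [set p : R * H | p.2 = op p.1];
  emb_inj : injective emb;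
  emb_continuous : continuous emb
}.

Section Sigma_space.
Context (K : realType) (R Y H : hilbertType K).
Implicit Type T : configurable_triple R Y H.

Definition in_Sigma T : {pred H} :=
  fun h => `[< exists r y, op T r + emb T y = h >].

Record Sigma T := MkSigma { Sigma_val : H; _ : Sigma_val \in in_Sigma T }.

HB.instance Definition _ T := [isSub for @Sigma_val T].
HB.instance Definition _ T := [Choice of Sigma T by <:].

Fact in_Sigma_submod T : GRing.submod_closed (in_Sigma T).
Proof.
split; first by apply/asboolP; exists 0, 0; rewrite !linear0 addr0.
move=> k _ _ /asboolP[r [y <-]] /asboolP[r' [y' <-]].
apply/asboolP; exists (k *: r + r'), (k *: y + y').
by rewrite !linearP scalerDr addrACA.
Qed.

HB.instance Definition _ T :=
  GRing.isSubmodClosed.Build K H (in_Sigma T) (in_Sigma_submod T).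
HB.instance Definition _ T := [SubChoice_isSubLmodule of Sigma T by <:].

Definition Sigma_norm T (s : Sigma T) : K :=
  inf [set x | exists r y, op T r + emb T y = val s /\ x = `|op T r| + `|y|].

Fact Sigma_norm_le T (s : Sigma T) r y :
  op T r + emb T y = val s -> Sigma_norm s <= `|op T r| + `|y|.
Proof.
move=> e; apply: ge_inf; last by exists r, y.
by exists 0 => _ [r' [y' [_ ->]]]; rewrite addr_ge0.
Qed.

Fact le_Sigma_norm T (s : Sigma T) x :
  (forall r y, op T r + emb T y = val s -> x <= `|op T r| + `|y|) ->
  x <= Sigma_norm s.
Proof.
move=> h; apply: lb_le_inf.
  have /asboolP[r [y e]] := valP s.
  by exists (`|op T r| + `|y|), r, y.
by move=> _ [r [y [e ->]]]; exact: h.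
Qed.

Fact Sigma_norm_ge0 T (s : Sigma T) : 0 <= Sigma_norm s.
Proof. by apply: le_Sigma_norm => r y _; rewrite addr_ge0. Qed.

Fact ler_Sigma_normD T (s t : Sigma T) :
  Sigma_norm (s + t) <= Sigma_norm s + Sigma_norm t.
Proof.
rewrite -lerBlDr; apply: le_Sigma_norm => r y es.
rewrite lerBlDr -lerBlDl; apply: le_Sigma_norm => r' y' et.
rewrite lerBlDl; apply: (le_trans (@Sigma_norm_le _ _ (r + r') (y + y') _)).
  by rewrite !linearD addrACA es et.
by rewrite linearD addrACA lerD// ler_normD.
Qed.

Fact Sigma_normZ_le T (k : K) (s : Sigma T) :
  Sigma_norm (k *: s) <= `|k| * Sigma_norm s.
Proof.
have [->|k0] := eqVneq k 0.
  rewrite scale0r normr0 mul0r.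
  by have := @Sigma_norm_le T 0 0 0; rewrite !linear0 addr0 !normr0 addr0; apply.
rewrite -ler_pdivrMl ?normr_gt0//; apply: le_Sigma_norm => r y e.
rewrite ler_pdivrMl ?normr_gt0// mulrDr -!normrZ -linearZ.
by apply: Sigma_norm_le; rewrite !linearZ -scalerDr e.
Qed.

Fact Sigma_normZ T (k : K) (s : Sigma T) :
  Sigma_norm (k *: s) = `|k| * Sigma_norm s.
Proof.
apply/eqP; rewrite eq_le Sigma_normZ_le /=.
have [->|k0] := eqVneq k 0; first by rewrite normr0 mul0r Sigma_norm_ge0.
rewrite -ler_pdivlMl ?normr_gt0// -normfV.
by rewrite -{1}(scalerK k0 s); exact: Sigma_normZ_le.
Qed.

Fact Sigma_norm_eq0 T (s : Sigma T) : Sigma_norm s = 0 -> s = 0.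
Proof.
move=> s0; apply: val_inj => /=; apply/normr0_eq0/le_anti.
rewrite normr_ge0 andbT.
have /linear_bounded_continuous/linear_boundedP/pinfty_ex_gt0[M M0 hM] :=
  @emb_continuous _ _ _ _ T.
suff : `|val s| / (1 + M) <= 0 by rewrite ler_pdivrMr ?mul0r// ltr_wpDr// ltW.
rewrite -s0; apply: le_Sigma_norm => r y <-.
rewrite ler_pdivrMr ?addr_gt0// (le_trans (ler_normD _ _))// mulrDr mulr1.
rewrite -addrA lerD2l (le_trans (hM y))// mulrDl.
by rewrite [M * _]mulrC addrA lerDr addr_ge0// mulr_ge0// ltW.
Qed.

HB.instance Definition _ T := @Lmodule_isNormed.Build K (Sigma T)
  (@Sigma_norm T) (@ler_Sigma_normD T) (@Sigma_normZ T) (@Sigma_norm_eq0 T).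

End Sigma_space.

Section Decoupling.
Context (K : realType) (R Y H V : hilbertType K).
Context (T : configurable_triple R Y H).

Fact SB_subproof (r : R) : op T r \in in_Sigma T.
Proof. by apply/asboolP; exists r, 0; rewrite linear0 addr0. Qed.

Definition SB (r : R) : Sigma T := MkSigma (SB_subproof r).

Fact SY_subproof (y : Y) : emb T y \in in_Sigma T.
Proof. by apply/asboolP; exists 0, y; rewrite linear0 add0r. Qed.

Definition SY (y : Y) : Sigma T := MkSigma (SY_subproof y).

Definition BR : set (Sigma T) := range SB.

Record Sigma_known : Prop := {
  Sigma_complete : forall F : set_system (Sigma T),
    ProperFilter F -> cauchy F -> cvg F;
  BR_closed : closed BR;
  BR_norms : norm_equiv (fun r => `|op T r|) (fun r => `|SB r|)
}.

(* [BY w] is the element of Y equal to B w; it is meaningful only when B w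
   belongs to Y. *)
Definition BY (w : R) : Y := xget 0 [set y | emb T y = op T w].

Section Primal.
Context (iV : {linear V -> R}) (aR : {bilinear R -> R -> K})
  (b : {bilinear R -> Y -> K}) (aY : {bilinear Y -> Y -> K}).

(* The inclusion of V in R is carried by the injective map [iV]. *)
Definition configurated : Prop :=
  [/\ injective iV,
      range iV = [set w | exists y, emb T y = op T w] &
      norm_equiv (fun v : V => `|v|) (fun v => `|iV v| + `|BY (iV v)|)].

Definition aform (u v : V) : K :=
  aR (iV u) (iV v) + b (iV u) (BY (iV v)) + b (iV v) (BY (iV u))
  + aY (BY (iV u)) (BY (iV v)).

Record hypothesis0 : Prop := {
  h0_configurated : configurated;
  h0_aR : [/\ bounded_form aR, forall u v, aR u v = aR v u &
              forall u, 0 <= aR u u];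
  h0_aY : [/\ bounded_form aY, forall y z, aY y z = aY z y &
              forall y, 0 <= aY y y];
  h0_b : bounded_form b;
  h0_dot : exists2 f : {dot V for @idfun K}, (forall u v, f u v = aform u v) &
             norm_equiv (fun v : V => Num.sqrt (f v v)) (fun v => `|v|)
}.

Definition assumptionII : Prop :=
  [/\ injective (op T), forall u v, aR u v = 0 & forall v z, b v z = 0].

Definition primal (fR : R -> K) (fY : Y -> K) (u : V) : Prop :=
  forall v, aform u v = fR (iV v) + fY (BY (iV v)).

End Primal.

Definition perp (c : Sigma T -> Sigma T -> K) (S : set (Sigma T))
  : set (Sigma T) := [set t | forall s, S s -> c t s = 0].

Definition polar (S : set (Sigma T)) : set {linear Sigma T -> K} :=
  [set g | continuous g /\ forall s, S s -> g s = 0].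

(* The infimum and the supremum are taken in the extended reals, so that the
   infimum over the empty set, when (BR)^perp = 0, is +oo.
   The conditions are one-sided in d, whereas the decoupled systems put the
   unknowns in either argument of d; they are to be imposed on d and on its
   transpose, which for a symmetric d amounts to imposing them once. *)
Record propertyI (c d : Sigma T -> Sigma T -> K) : Prop := {
  propI_continuous : continuous (fun p : Sigma T * Sigma T => d p.1 p.2);
  propI_BR : forall (s : R) (t : Sigma T), d (SB s) t = 0;
  propI_infsup : exists2 C : K, 0 < C &
    (C%:E <= ereal_inf
       [set ereal_sup [set (d t s / (`|t| * `|s|))%:E
                      | s in perp c BR `\ 0%R]
       | t in perp c BR `\ 0%R])%E
}.

Section Systems.
Context (aR : R -> R -> K) (b : R -> Y -> K) (aY : Y -> Y -> K)
  (c d : Sigma T -> Sigma T -> K) (fR : R -> K) (fY : Y -> K).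

Definition S5 (p u : R) (y : Y) (xi : Sigma T) (r : R) : Prop :=
  forall (q v : R) (z : Y) (eta : Sigma T) (s : R),
  [/\ c xi (SB q) = 0,
      aR u v + b v y + c (SB r) (SB v) = fR v,
      b u z + aY y z - d xi (SY z) - c (SB r) (SY z) = fY z,
      c eta (SB p) - d eta (SY y) = 0 &
      c (SB s) (SB u) - c (SB s) (SY y) = 0].

Definition S4 (u : R) (y : Y) (g0 gp : {linear Sigma T -> K}) : Prop :=
  [/\ polar BR g0, polar (perp c BR) gp &
    forall (v : R) (z : Y) (l0 lp : {linear Sigma T -> K}),
    polar BR l0 -> polar (perp c BR) lp ->
    [/\ aR u v + b v y + gp (SB v) = fR v,
        b u z + aY y z - g0 (SY z) - gp (SY z) = fY z,
        - l0 (SY y) = 0 &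
        lp (SB u) - lp (SY y) = 0]].

Definition problem_a (r : R) : Prop :=
  forall v : R, c (SB r) (SB v) = fR v.

Definition problem_b (r p : R) (y : Y) (xi : Sigma T) : Prop :=
  forall (q : R) (z : Y) (eta : Sigma T),
  [/\ aY y z - d xi (SY z) = fY z + c (SB r) (SY z),
      c xi (SB q) = 0 &
      - d (SY y) eta + c eta (SB p) = 0].

Definition problem_b' (r : R) (y : Y) (xi : Sigma T) : Prop :=
  forall (z : Y) (eta : Sigma T),
    aY y z - d xi (SY z) = fY z + c (SB r) (SY z) /\ - d (SY y) eta = 0.

Definition problem_c (y : Y) (u : R) : Prop :=
  forall s : R, c (SB u) (SB s) = c (SY y) (SB s).

End Systems.

End Decoupling.

(* Main.v *)
(** The open mapping theorem turns the given facts on [BR] into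
    [|r| <= C |Br|], so every continuous functional on [R] is represented by
    [c (Br, B.)]. Testing the third equation of (b) with [eta = Bp] gives
    [c (Bp, Bp) = d (y, Bp) = 0], hence [p = 0]; the equation then says that
    [d (y, .)] vanishes, and the inf-sup condition makes [BR] the kernel of [d]
    on either side, so [y = Bu] for some [u] in [V]. On test functions [z = Bv]
    the terms in [d] disappear and [c (Br, Bv) = <f_R, v>], so that [u] solves
    the primal problem, which is a Riesz problem for [a]. Conversely, for
    [y = Bu] with [u] the primal solution, the residual of the first equation
    of (b) vanishes on [Y] inter [BR], extends by [0] on [BR] to a bounded
    functional on [Sigma], and is therefore [d (xi, .)] by the inf-sup condition
    (Babuska-Necas). *)

Require Import Defs.
From HB Require Import structures.
From mathcomp Require Import all_boot all_order all_algebra.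
From mathcomp Require Import all_classical all_reals all_analysis.
From mathcomp Require Import ring lra.

Set Implicit Arguments.
Unset Strict Implicit.
Unset Printing Implicit Defensive.

Import Order.TTheory GRing.Theory Num.Theory.
Import numFieldNormedType.Exports.

Local Open Scope classical_set_scope.
Local Open Scope ring_scope.

(** * Riesz representation on closed subspaces and the inf-sup condition *)

Section CoerciveForms.
Context (K : realType) (X : normedModType K).

(** Completeness stated as a property of a normed space, since that of [Sigma T] comes from a
    hypothesis and not from its structure. *)
Definition seq_complete : Prop := forall u : nat -> X,
  (forall e : K, 0 < e -> exists N, forall m n, (N <= m)%N -> (N <= n)%N ->
    `|u m - u n| < e) ->
  exists x : X, u @ \oo --> x.

Definition subspace (S : set X) : Prop :=
  S 0 /\ forall (k : K) x y, S x -> S y -> S (k *: x + y).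

(** Relative to [S] because some functionals below are built by choosing a preimage and make sense
    on [BR] only. *)
Definition linear_on (S : set X) (F : X -> K) : Prop :=
  forall (k : K) x y, S x -> S y -> F (k *: x + y) = k * F x + F y.

Definition bounded_on (S : set X) (F : X -> K) : Prop :=
  exists M, forall x, S x -> `|F x| <= M * `|x|.

(** Only coercivity is confined to [S]: the form [c (D x) (D y)] used for the inf-sup condition is
    coercive on a subspace alone. *)
Record coercive_form (S : set X) (e : X -> X -> K) : Prop := {
  cf_linear : forall (k : K) x y z, e (k *: x + y) z = k * e x z + e y z;
  cf_sym : forall x y, e x y = e y x;
  cf_bounded : exists2 M, 0 < M & forall x y, `|e x y| <= M * `|x| * `|y|;
  cf_coercive : exists2 a, 0 < a & forall x, S x -> a * `|x| ^+ 2 <= e x x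
}.

Lemma subspaceT : subspace setT. Proof. by []. Qed.

Lemma subspaceD S x y : subspace S -> S x -> S y -> S (x + y).
Proof. by move=> [_ h] Sx Sy; have := h 1 x y Sx Sy; rewrite scale1r. Qed.

Lemma subspaceZ S k x : subspace S -> S x -> S (k *: x).
Proof. by move=> [S0 h] Sx; have := h k x 0 Sx S0; rewrite addr0. Qed.

Lemma subspaceB S x y : subspace S -> S x -> S y -> S (x - y).
Proof.
by move=> hS Sx Sy; rewrite -scaleN1r; apply: subspaceD => //; exact: subspaceZ.
Qed.

Section form.
Context (S : set X) (e : X -> X -> K) (he : coercive_form S e).

Lemma cfD x y z : e (x + y) z = e x z + e y z.
Proof. by have := cf_linear he 1 x y z; rewrite scale1r mul1r. Qed.

Lemma cf0 z : e 0 z = 0.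
Proof. by have := cfD 0 0 z; rewrite addr0 => /eqP; rewrite -subr_eq subrr => /eqP. Qed.

Lemma cfZ k x z : e (k *: x) z = k * e x z.
Proof. by have := cf_linear he k x 0 z; rewrite addr0 cf0 addr0. Qed.

Lemma cfB x y z : e (x - y) z = e x z - e y z.
Proof. by rewrite cfD -scaleN1r cfZ mulN1r. Qed.

Lemma cfDr x y z : e z (x + y) = e z x + e z y.
Proof. by rewrite !(cf_sym he z) cfD. Qed.

Lemma cfZr k x z : e z (k *: x) = k * e z x.
Proof. by rewrite !(cf_sym he z) cfZ. Qed.

Lemma cfBr x y z : e z (x - y) = e z x - e z y.
Proof. by rewrite !(cf_sym he z) cfB. Qed.

Lemma cf_ge0 x : S x -> 0 <= e x x.
Proof.
have [a a0 h] := cf_coercive he => /h; apply: le_trans.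
by rewrite mulr_ge0// ?ltW// exprn_ge0.
Qed.

Lemma cf_eq0 x : S x -> e x x = 0 -> x = 0.
Proof.
have [a a0 h] := cf_coercive he => /h + e0; rewrite e0 pmulr_rle0// => x0.
by apply/normr0_eq0/eqP; rewrite -sqrf_eq0 eq_le x0 exprn_ge0.
Qed.

Lemma cf_unique x y : subspace S -> S x -> S y ->
  (forall z, S z -> e x z = e y z) -> x = y.
Proof.
move=> hS Sx Sy h; apply/eqP; rewrite -subr_eq0; apply/eqP.
have Sxy : S (x - y) by exact: subspaceB.
by apply: cf_eq0 => //; rewrite cfB h// subrr.
Qed.

(* The minimum of [J x = e x x - 2 F x] over [S]: by the parallelogram identity
   every minimising sequence is Cauchy. *)
Lemma riesz_subspace (F : X -> K) : seq_complete -> subspace S -> closed S ->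
  linear_on S F -> bounded_on S F ->
  exists2 x, S x & forall y, S y -> e x y = F y.
Proof.
move=> cX hS cS lF [N bF]; have [S0 _] := hS.
have [M M0 bM] := cf_bounded he; have [a a0 ha] := cf_coercive he.
have F0 : F 0 = 0.
  by have := lF 1 0 0 S0 S0; rewrite scale1r addr0 mul1r => /eqP;
    rewrite -subr_eq subrr => /eqP.
have FZ k x : S x -> F (k *: x) = k * F x.
  by move=> Sx; have := lF k x 0 Sx S0; rewrite addr0 F0 addr0.
have FD x y : S x -> S y -> F (x + y) = F x + F y.
  by move=> Sx Sy; have := lF 1 x y Sx Sy; rewrite scale1r mul1r.
pose J x := e x x - 2 * F x.
(* Completing the square in [a * |x|^2 - 2 * N * |x|]. *)
have Jge x : S x -> - (N ^+ 2 / a) <= J x.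
  move=> Sx; have := ha _ Sx; have := bF _ Sx; rewrite ler_norml => /andP[_ h1] h2.
  have : 0 <= (a * `|x| - N) ^+ 2 / a by rewrite divr_ge0 ?sqr_ge0// ltW.
  have -> : (a * `|x| - N) ^+ 2 / a = a * `|x| ^+ 2 - 2 * N * `|x| + N ^+ 2 / a.
    by field; rewrite gt_eqF.
  rewrite /J; lra.
pose m := inf (J @` S).
have hinf : has_inf (J @` S).
  split; first by exists (J 0), 0.
  by exists (- (N ^+ 2 / a)) => _ [x Sx <-]; exact: Jge.
have mJ x : S x -> m <= J x by move=> Sx; apply: ge_inf; [exact: hinf.2|exists x].
have ex n : exists x, S x /\ J x < m + n.+1%:R^-1.
  have e0 : 0 < n.+1%:R^-1 :> K by rewrite invr_gt0.
  by have [_ [x Sx <-] Jx] := inf_adherent e0 hinf; exists x.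
have [u hu] := choice ex.
have Su n : S (u n) by case: (hu n).
(* With [w] the midpoint of [x] and [y], [e (x - y) (x - y) = 2 * (J x + J y - 2 * J w)], and
   [m <= J w]. *)
have par x y : S x -> S y -> a * `|x - y| ^+ 2 <= 2 * (J x + J y - 2 * m).
  move=> Sx Sy; apply: (le_trans (ha _ (subspaceB hS Sx Sy))).
  have Sxy : S (2^-1 *: (x + y)) by apply: subspaceZ => //; exact: subspaceD.
  have := mJ _ Sxy; rewrite /J FZ ?FD//; last exact: subspaceD.
  rewrite !cfB !cfBr !(cfZ, cfZr, cfD, cfDr) (cf_sym he y x); lra.
have vn (n k : nat) : (n <= k)%N -> k.+1%:R^-1 <= n.+1%:R^-1 :> K.
  by move=> nk; rewrite lef_pV2 ?posrE// ler_nat ltnS.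
have [|x ux] := cX u.
  move=> d d0; have d1 : 0 < a * d ^+ 2 / 4 by rewrite divr_gt0// mulr_gt0// exprn_gt0.
  have [n hn] : exists n : nat, n.+1%:R^-1 < a * d ^+ 2 / 4.
    by have [n _ /(_ _ (leqnn n))] := near_infty_natSinv_lt (PosNum d1); exists n.
  exists n => i j ni nj.
  have := par _ _ (Su i) (Su j); have := (hu i).2; have := (hu j).2.
  have := vn _ _ ni; have := vn _ _ nj => h1 h2 h3 h4 h5.
  rewrite -(ltr_pXn2r (n:=2)) ?nnegrE ?(ltW d0)// -(ltr_pM2l a0).
  have alg (D P p q r v w z : K) : P < D / 4 -> q <= P -> r <= P ->
    v < z + q -> w < z + r -> p <= 2 * (v + w - 2 * z) -> p < D by lra.
  exact: alg hn h2 h1 h4 h3 h5.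
have Sx : S x.
  by apply: (closed_cvg S cS _ _ ux); apply: nearW => n; exact: Su.
exists x => // y Sy.
have [y0|y0] := eqVneq (e y y) 0.
  by rewrite (cf_eq0 Sy y0) (cf_sym he) cf0 F0.
have ey : 0 < e y y by rewrite lt0r y0 cf_ge0.
(* Along the line [z + t *: y] the best [t] lowers [J] by [(e z y - F y) ^+ 2 / e y y], which cannot
   exceed the gap [p]. The Euler equation itself is then passed to the limit, without evaluating [J]
   there. *)
have var p z : S z -> J z < m + p -> (e z y - F y) ^+ 2 <= e y y * p.
  move=> Sz hz; pose t := - (e z y - F y) / e y y.
  have St : S (t *: y) by exact: subspaceZ.
  have := mJ _ (subspaceD hS Sz St); move: hz.
  rewrite /J FD// FZ// !(cfD, cfDr) !(cfZ, cfZr) (cf_sym he y z) => h1 h2.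
  have h3 : 0 <= p + (2 * t * (e z y - F y) + t ^+ 2 * e y y) by lra.
  have h4 : 2 * t * (e z y - F y) + t ^+ 2 * e y y =
    - ((e z y - F y) ^+ 2 / e y y) by rewrite /t; field.
  by move: h3; rewrite h4 subr_ge0 ler_pdivrMr// mulrC.
have lim1 : (fun n => e (u n) y - F y) @ \oo --> e x y - F y.
  apply: cvgB; last exact: cvg_cst.
  apply/cvgrPdist_lt => d d0.
  have d1 : 0 < d / (M * `|y| + 1).
    by rewrite divr_gt0// ltr_wpDl// mulr_ge0// ltW.
  move/cvgrPdist_lt: ux => /(_ _ d1); apply: filterS => n h.
  rewrite -cfB; apply: (le_lt_trans (bM _ _)).
  have My : 0 <= M * `|y| by rewrite mulr_ge0// ltW.
  move: h; rewrite ltr_pdivlMr; last by rewrite ltr_wpDl.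
  by apply: le_lt_trans; rewrite mulrDr mulr1 mulrAC [leLHS]mulrC lerDl.
have lim2 : (fun n => (e (u n) y - F y) ^+ 2) @ \oo --> (0 : K).
  have dom : (fun n => e y y * n.+1%:R^-1) @ \oo --> (0 : K).
    rewrite -(mulr0 (e y y)); apply: cvgM; [exact: cvg_cst|exact: cvg_harmonic].
  apply: (squeeze_cvgr _ (cvg_cst (0 : K)) dom).
  apply: nearW => n; rewrite sqr_ge0 /=.
  by apply: var => //; case: (hu n).
have lim3 : (fun n => (e (u n) y - F y) ^+ 2) @ \oo --> (e x y - F y) ^+ 2.
  by under eq_fun do rewrite expr2; rewrite expr2; exact: cvgM.
have /eqP : (e x y - F y) ^+ 2 = 0.
  by apply: (cvg_unique _ lim3 lim2); exact: Rhausdorff.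
by rewrite sqrf_eq0 subr_eq0 => /eqP.
Qed.

End form.

Lemma dot_cauchy_schwarz (f : {dot X for @idfun K}) x y :
  f x y ^+ 2 <= f x x * f y y.
Proof.
have fC u v : f u v = f v u.
  by rewrite (@hermitian_subproof _ _ _ _ f) /= expr0 mul1r.
have [->|y0] := eqVneq y 0; first by rewrite !linear0r expr0n.
have fy : 0 < f y y by exact: neq0_dnorm_gt0.
have fge0 z : 0 <= f z z.
  by have [->|z0] := eqVneq z 0; [rewrite linear0r|exact/ltW/neq0_dnorm_gt0].
have := fge0 (- (f x y / f y y) *: y + x).
rewrite !(linearPr, linearPl) /= (fC y x).
set p := f x x; set q := f x y; set r := f y y in fy *.
have -> : - (q / r) * (- (q / r) * r + q) + (- (q / r) * q + p) = p - q ^+ 2 / r.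
  by field; rewrite gt_eqF.
by rewrite subr_ge0 ler_pdivrMr.
Qed.

Lemma dot_coercive (f : {dot X for @idfun K}) :
  norm_equiv (fun x => Num.sqrt (f x x)) (fun x => `|x|) ->
  coercive_form setT f.
Proof.
move=> [C1 [C2 [C10 C20 hC]]].
have fge0 z : 0 <= f z z.
  by have [->|z0] := eqVneq z 0; [rewrite linear0r|exact/ltW/neq0_dnorm_gt0].
split.
- by move=> k x y z; rewrite linearPl.
- by move=> x y; rewrite (@hermitian_subproof _ _ _ _ f) /= expr0 mul1r.
- exists (C1 * C1) => [|x y]; first exact: mulr_gt0.
  rewrite -sqrtr_sqr (le_trans (ler_wsqrtr (dot_cauchy_schwarz f x y)))//.
  rewrite sqrtrM// -[leRHS]mulrA mulrACA.
  by apply: ler_pM; rewrite ?sqrtr_ge0//; [case: (hC x)|case: (hC y)].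
- exists (C2 ^- 2) => [|x _]; first by rewrite invr_gt0 exprn_gt0.
  rewrite mulrC ler_pdivrMr ?exprn_gt0// mulrC -[X in _ * X]sqr_sqrtr// -exprMn.
  by rewrite lerXn2r ?nnegrE ?mulr_ge0 ?sqrtr_ge0// ?(ltW C20)//; case: (hC x).
Qed.

End CoerciveForms.

Section Completeness.
Context (K : realType) (X : normedModType K).

Lemma cauchy_seq_complete :
  (forall F : set_system X, ProperFilter F -> cauchy F -> cvg F) ->
  seq_complete X.
Proof.
move=> hX u hu; exists (lim (u @ \oo)); apply: hX; apply: cauchy_exP => e e0.
have [N hN] := hu e e0; exists (u N); exists N => // n /= Nn.
by rewrite -ball_normE /=; exact: hN.
Qed.

Lemma coercive_subset (S S' : set X) (e : X -> X -> K) :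
  S' `<=` S -> coercive_form S e -> coercive_form S' e.
Proof.
move=> SS' [el es eb [a a0 ea]]; split => //.
by exists a => // x /SS'; exact: ea.
Qed.

Lemma closed_perp (S : set X) (c : X -> X -> K) :
  coercive_form setT c -> closed [set t | forall s, S s -> c t s = 0].
Proof.
move=> hc; have [M M0 bM] := cf_bounded hc.
move=> t ht s Ss; apply/normr0_eq0/le_anti; rewrite normr_ge0 andbT.
apply/ler_addgt0Pl => e e0; rewrite addr0.
(* The [+ 1] keeps the denominator positive when [s = 0]. *)
have d0 : 0 < e / (M * `|s| + 1).
  by rewrite divr_gt0// ltr_wpDl// mulr_ge0// ltW.
have [x [hx]] := ht _ (nbhsx_ballx t _ d0).
rewrite -ball_normE /= => tx.
have -> : c t s = c (t - x) s by rewrite (cfB hc) hx// subr0.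
apply: (le_trans (bM _ _)).
have My : 0 <= M * `|s| by rewrite mulr_ge0// ltW.
move: tx; rewrite ltr_pdivlMr; last by rewrite ltr_wpDl.
by move/ltW; apply: le_trans; rewrite mulrDr mulr1 mulrAC [leLHS]mulrC lerDl.
Qed.

Lemma subspace_perp (S : set X) (c : X -> X -> K) :
  coercive_form setT c -> subspace [set t | forall s, S s -> c t s = 0].
Proof.
move=> hc; split=> [s _|k x y hx hy s Ss]; first by rewrite (cf0 hc).
by rewrite (cf_linear hc) hx// hy// mulr0 addr0.
Qed.

(* With [d x y = c (D x) y], the inf-sup condition makes [c (D x) (D y)]
   coercive on [S]; Riesz for that form solves [D x = w] up to a vector that is
   orthogonal to the range of [D], which the transposed condition kills. *)
Lemma infsup_surjective (S : set X) (c d : X -> X -> K) (F : X -> K) :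
  seq_complete X -> coercive_form setT c -> subspace S -> closed S ->
  (forall (k : K) x y z, d (k *: x + y) z = k * d x z + d y z) ->
  (forall (k : K) x y z, d z (k *: x + y) = k * d z x + d z y) ->
  (exists2 M, 0 < M & forall x y, `|d x y| <= M * `|x| * `|y|) ->
  (exists2 a, 0 < a & forall x, S x -> x != 0 ->
    exists2 y, S y & a * (`|x| * `|y|) < d x y) ->
  (forall y, S y -> (forall x, S x -> d x y = 0) -> y = 0) ->
  linear_on S F -> bounded_on S F ->
  exists2 x, S x & forall y, S y -> d x y = F y.
Proof.
move=> cX hc hS cS dl dr [M M0 bM] [a a0 hinf] nd lF bF.
have hcS : coercive_form S c by apply: coercive_subset hc.
have [Mc Mc0 bMc] := cf_bounded hc; have [ac ac0 hac] := cf_coercive hc.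
have exD x : exists z, S z /\ forall y, S y -> c z y = d x y.
  have [|//|z Sz hz] := riesz_subspace hcS (F := d x) cX hS cS.
  - by move=> k y z _ _; exact: dr.
  - by exists (M * `|x|).
  - by exists z.
have [D hD] := choice exD.
have SD x : S (D x) by case: (hD x).
have DE x y : S y -> c (D x) y = d x y by case: (hD x) => _; exact.
have Dlin k x y : D (k *: x + y) = k *: D x + D y.
  apply: (cf_unique hcS) => //; first by case: hS => _; apply.
  by move=> z Sz; rewrite (cf_linear hc) !DE// dl.
(* From [ac * |D x|^2 <= c (D x) (D x) = d x (D x) <= M * |x| * |D x|]. *)
have Dbnd x : `|D x| <= M / ac * `|x|.
  have [->|Dx0] := eqVneq (D x) 0.
    by rewrite normr0 mulr_ge0// divr_ge0// ltW.
  rewrite mulrAC ler_pdivlMr// mulrC.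
  have Dp : 0 < `|D x| by rewrite normr_gt0.
  rewrite -(ler_pM2r Dp) -mulrA -expr2 (le_trans (hac _ I))// DE//.
  exact: (le_trans (ler_norm _)).
have [w Sw hw] := riesz_subspace hcS cX hS cS lF bF.
pose e x y := c (D x) (D y).
have he : coercive_form S e.
  split.
  - by move=> k x y z; rewrite /e Dlin (cf_linear hc).
  - by move=> x y; rewrite /e (cf_sym hc).
  - have Ma0 : 0 < M / ac by exact: divr_gt0.
    exists (Mc * (M / ac) * (M / ac)); first by do 2!apply: mulr_gt0 => //.
    move=> x y; apply: (le_trans (bMc _ _)).
    have -> : Mc * (M / ac) * (M / ac) * `|x| * `|y| =
      Mc * (M / ac * `|x|) * (M / ac * `|y|) by ring.
    by apply: ler_pM; rewrite ?mulr_ge0 ?ler_wpM2l// ltW.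
  (* The inf-sup vector [y] gives [a * |x| * |y| < c (D x) y <= Mc * |D x| * |y|], hence
     [a / Mc * |x| <= |D x|]. *)
  - exists (ac * (a / Mc) ^+ 2); first by rewrite mulr_gt0// exprn_gt0// divr_gt0.
    move=> x Sx; rewrite (le_trans _ (hac (D x) I))// -mulrA ler_pM2l//.
    rewrite -exprMn lerXn2r ?nnegrE ?mulr_ge0// ?invr_ge0 ?(ltW a0) ?(ltW Mc0)//.
    have [->|x0] := eqVneq x 0; first by rewrite normr0 mulr0.
    have [y Sy hy] := hinf _ Sx x0.
    have {}hy : a * (`|x| * `|y|) < Mc * `|D x| * `|y|.
      by apply: (lt_le_trans hy); rewrite -DE//; apply: (le_trans (ler_norm _)).
    rewrite mulrAC ler_pdivrMr// [leRHS]mulrC.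
    have [y0|y0] := eqVneq y 0; first by move: hy; rewrite y0 normr0 !mulr0 ltxx.
    by move: hy; rewrite mulrA ltr_pM2r ?normr_gt0// => /ltW.
have [||x Sx hx] := riesz_subspace he (F := fun y => c w (D y)) cX hS cS.
- by move=> k x y _ _; rewrite Dlin (cf_sym hc) (cf_linear hc) !(cf_sym hc _ w).
- exists (Mc * `|w| * (M / ac)) => x _; apply: (le_trans (bMc _ _)).
  by rewrite -[leRHS]mulrA ler_wpM2l// mulr_ge0// ltW.
exists x => // y Sy; rewrite -DE// -hw//; congr (c _ y).
(* [D x - w] is [c]-orthogonal to every [D z], which says [d z (D x - w) = 0]. *)
apply/eqP; rewrite -subr_eq0; apply/eqP/nd; first exact: subspaceB.
move=> z Sz; rewrite -DE; last exact: subspaceB.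
by rewrite (cf_sym hc) (cfB hc) -hx// subrr.
Qed.

End Completeness.

Lemma complete_seq_complete (K : realType) (X : completeNormedModType K) :
  seq_complete X.
Proof. by apply: cauchy_seq_complete => F FF; exact: cauchy_cvg. Qed.

(** * Injective closed operators with closed range *)

Section BoundedBelow.
Context (K : realType) (R H : completeNormedModType K) (A : {linear R -> H}).
Context (h : H -> H -> K) (hc : coercive_form setT h).
Hypothesis hE : forall x, h x x = `|x| ^+ 2.
Hypothesis clA : closed [set p : R * H | p.2 = A p.1].
Hypothesis injA : injective A.
Hypothesis clR : closed (range A).

Lemma subspace_range : subspace (range A).
Proof.
split; first by exists 0; rewrite ?linear0.
by move=> k _ _ [x _ <-] [y _ <-]; exists (k *: x + y); rewrite ?linearP.
Qed.

(** The points whose [h]-orthogonal projection on [range A] is the image of a vector of norm at most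
    [n]. Projecting allows Baire's theorem to be applied in all of [H]. *)
Let level (n : nat) : set H :=
  [set y | exists r, `|r| <= n%:R /\ forall s, h (y - A r) (A s) = 0].

Let level_cover (y : H) : exists n, level n y.
Proof.
have hcA := coercive_subset (@subsetT _ (range A)) hc.
have [||_ [r _ <-] hr] := riesz_subspace hcA (F := h y)
  (@complete_seq_complete _ H) subspace_range clR.
- by move=> k u v _ _; rewrite (cfDr hc) (cfZr hc).
- have [M _ bM] := cf_bounded hc.
  by exists (M * `|y|).
exists (Num.truncn `|r|).+1, r; split; first by apply/ltW/truncnS_gt.
by move=> s; rewrite (cfB hc) hr ?subrr//; exists s.
Qed.

(** Otherwise the complements of the closed levels are open and dense, and by Baire some point lies
    in no level. *)
Let level_dense : exists n x e, 0 < e /\ ball x e `<=` closure (level n).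
Proof.
apply: contrapT => hno.
pose F n := ~` closure (level n).
have dF : dense (\bigcap_i F i).
  apply: Baire => i; split; first by rewrite openC; exact: closed_closure.
  apply: contrapT => /denseNE[U [[x /open_nbhs_nbhs/nbhs_ballP[e e0 xe]] UF]].
  apply: hno; exists i, x, e; split => // y /xe Uy; apply: contrapT => Ny.
  by rewrite -[False]/(set0 y) -UF.
have [x [_ Fx]] := dF setT (ex_intro _ 0 I) openT.
have [n xn] := level_cover x.
exact: (Fx n I (subset_closure xn)).
Qed.

Let approx : exists2 C, 0 < C & forall x d, 0 < d ->
  exists2 y, `|x - y| <= C * `|A x| & `|A y| < d.
Proof.
have [n [x0 [e [e0 he]]]] := level_dense.
have pyth u v : h u v = 0 -> `|u| ^+ 2 <= `|u + v| ^+ 2.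
  move=> uv; rewrite -!hE (cfD hc) !(cfDr hc) uv (cf_sym hc v u) uv.
  by rewrite addr0 add0r !hE lerDl exprn_ge0.
(* Both [x0] and [x0 + A x] are limits of points of [level n]. Their preimages [r2] and [r1] differ
   by an approximate preimage of [A x], and [pyth] discards the parts orthogonal to the range. *)
have small x d : `|A x| < e -> 0 < d ->
    exists2 r, `|r| <= n%:R + n%:R & `|A (x - r)| < d.
  move=> xe d0; have d2 : 0 < d / 2 by rewrite divr_gt0.
  have [|h1 [[r1 [nr1 p1]] b1]] := he (x0 + A x) _ _ (nbhsx_ballx _ _ d2).
    by rewrite -ball_normE /= opprD addNKr normrN.
  have [|h2 [[r2 [nr2 p2]] b2]] := he x0 _ _ (nbhsx_ballx _ _ d2).
    exact: ballxx.
  exists (r1 - r2); first by apply: (le_trans (ler_normB _ _)); exact: lerD.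
  pose t := (h1 - A r1) - (h2 - A r2).
  have := pyth (A (x - (r1 - r2))) (- t).
  have -> : h (A (x - (r1 - r2))) (- t) = 0.
    by rewrite (cf_sym hc) -scaleN1r (cfZ hc) (cfB hc) p1 p2 subrr mulr0.
  move=> /(_ erefl); rewrite ler_pXn2r ?nnegrE// => /le_lt_trans; apply.
  move: b1 b2; rewrite -!ball_normE /= => b1 b2.
  have -> : A (x - (r1 - r2)) + - t = (x0 + A x - h1) - (x0 - h2).
    have -> : A (x - (r1 - r2)) - t = A x - (h1 - h2).
      rewrite [A (x - _)]linearB [A (r1 - r2)]linearB /t -addrA -opprD.
      by congr (_ - _); rewrite opprB addrCA !subrKA.
    by rewrite !opprB -[x0 + _ - _]addrA [RHS]addrC subrKA addrCA.
  by apply: (le_lt_trans (ler_normB _ _)); rewrite (splitr d); exact: ltrD.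
(* Scaling by [t = e / (2 * |A x|)] brings [A x] to norm [e / 2]; scaling back divides the bound
   [2 * n] by [t]. The [+ 1] keeps the constant positive when [n = 0]. *)
exists (2 * (n%:R + n%:R + 1) / e) => [|x d d0].
  by rewrite divr_gt0// mulr_gt0// ltr_wpDl// addr_ge0.
have [Ax0|Ax0] := eqVneq (A x) 0.
  by exists x; rewrite ?Ax0 ?subrr ?normr0 ?mulr0.
have Ap : 0 < `|A x| by rewrite normr_gt0.
pose t := e / (2 * `|A x|).
have t0 : 0 < t by rewrite divr_gt0// mulr_gt0.
have [||r nr rd] := small (t *: x) (t * d).
- rewrite linearZ normrZ gtr0_norm// /t.
  have -> : e / (2 * `|A x|) * `|A x| = e / 2 by field; rewrite gt_eqF.
  by rewrite ltr_pdivrMr// ltr_pMr// ltr1n.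
- exact: mulr_gt0.
exists (x - t^-1 *: r).
  rewrite opprB addrC subrK normrZ normfV (gtr0_norm t0) ler_pdivrMl//.
  have -> : t * (2 * (n%:R + n%:R + 1) / e * `|A x|) = n%:R + n%:R + 1.
    by rewrite /t; field; rewrite !gt_eqF.
  by rewrite (le_trans nr)// lerDl.
have -> : x - t^-1 *: r = t^-1 *: (t *: x - r).
  by rewrite scalerBr scalerA mulVf ?scale1r// gt_eqF.
by rewrite linearZ normrZ normfV (gtr0_norm t0) ltr_pdivrMl.
Qed.

(* Successive approximation: the [x n] stay within a geometric distance of each
   other while [A (x n)] tends to [0], so that by closedness they tend to [0]. *)
Lemma bounded_below : exists2 C, 0 < C & forall r, `|r| <= C * `|A r|.
Proof.
have [C C0 hC] := approx.
exists (2 * C) => [|r]; first exact: mulr_gt0.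
have [->|r0] := eqVneq r 0; first by rewrite normr0 mulr_ge0// mulr_ge0// ltW.
pose q : K := 2^-1; pose b := `|A r|.
have b0 : 0 < b.
  by rewrite normr_gt0 -(linear0 A) (inj_eq injA).
have q0 n : 0 < q ^+ n by rewrite exprn_gt0// invr_gt0.
(* The pair holds the current vector and the step index, so that one choice function drives the
   recursion. *)
have exg (p : R * nat) : exists y, `|p.1 - y| <= C * `|A p.1| /\
    `|A y| < b * q ^+ p.2.+1.
  by have [y] := hC p.1 (b * q ^+ p.2.+1) (mulr_gt0 b0 (q0 _)); exists y.
have [g hg] := choice exg.
pose x := fix x n := if n is n'.+1 then g (x n', n') else r.
have Ax n : `|A (x n)| <= b * q ^+ n.
  case: n => [|n] /=; first by rewrite expr0 mulr1.
  by apply: ltW; case: (hg (x n, n)).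
have step n : `|x n - x n.+1| <= C * b * q ^+ n.
  have [xx _] := hg (x n, n); apply: (le_trans xx).
  by rewrite -mulrA ler_pM2l//; exact: Ax.
(* As [q = 1/2], each step bound [C * b * q ^+ n] equals [2 * C * b * (q ^+ n - q ^+ n.+1)] and the
   sum telescopes. *)
have tail n k : `|x n - x (n + k)%N| <= 2 * C * b * (q ^+ n - q ^+ (n + k)).
  elim: k => [|k IH]; first by rewrite addn0 !subrr normr0 mulr0.
  rewrite addnS; apply: (le_trans (ler_distD (x (n + k)%N) _ _)).
  apply: (le_trans (lerD IH (step _))); rewrite exprS.
  by rewrite le_eqVlt; apply/orP; left; apply/eqP; rewrite /q; field.
have tail' n k : (n <= k)%N -> `|x n - x k| <= 2 * C * b * q ^+ n.
  move=> nk; rewrite -(subnKC nk); apply: (le_trans (tail _ _)).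
  by rewrite ler_wpM2l ?gerBl ?(ltW (q0 _))// !mulr_ge0// ltW.
have qlim : (fun n => q ^+ n) @ \oo --> (0 : K).
  by apply: cvg_expr; rewrite ger0_norm ?invr_ge0// invf_lt1// ltr1n.
have [|l xl] := @complete_seq_complete _ R x.
  move=> e e0; have D0 : 0 < e / (4 * C * b).
    by rewrite divr_gt0// !mulr_gt0.
  move/cvgrPdist_lt: qlim => /(_ _ D0) [N _ hN]; exists N => m n Nm Nn.
  apply: (le_lt_trans (ler_distD (x N) _ _)); rewrite distrC.
  apply: (le_lt_trans (lerD (tail' _ _ Nm) (tail' _ _ Nn))).
  have := hN N (leqnn N); rewrite sub0r normrN gtr0_norm//.
  rewrite ltr_pdivlMr ?mulr_gt0//; lra.
have Al : A (x n) @[n --> \oo] --> (0 : H).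
  apply/cvgrPdist_lt => e e0; have D0 : 0 < e / b by rewrite divr_gt0.
  move/cvgrPdist_lt: qlim => /(_ _ D0); apply: filterS => n.
  rewrite !sub0r !normrN gtr0_norm// ltr_pdivlMr// mulrC.
  exact/le_lt_trans/Ax.
(* The pairs [(x n, A (x n))] stay in the closed graph and tend to [(l, 0)]. *)
have l0 : l = 0.
  apply: injA; rewrite linear0; apply/esym.
  apply: (@closed_cvg _ _ \oo eventually_filter (fun n => (x n, A (x n))) _ clA
    _ (l, 0)); first by apply: nearW.
  exact: cvg_pair.
have -> : `|r| = `|x 0%N - l| by rewrite l0 subr0.
rewrite -/b; apply: (closed_cvg (fun y => `|x 0%N - y| <= 2 * C * b) _ _ _ xl).
  apply: (@closed_comp _ _ (fun y => `|x 0%N - y|) [set z | z <= 2 * C * b]).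
    move=> y _; apply: cvg_norm; apply: cvgB; [exact: cvg_cst|exact: cvg_id].
  exact: closed_le.
by apply: nearW => n; have := tail' 0%N n (leq0n n); rewrite expr0 mulr1.
Qed.

End BoundedBelow.

Lemma hdot_coercive (K : realType) (E : hilbertType K) :
  coercive_form setT (@hdot K E).
Proof.
apply: dot_coercive; exists 1, 1; split => // x.
by rewrite hdotE sqrtr_sqr normr_id mul1r.
Qed.

(** * The space Sigma *)

Lemma continuous_boundedP (K : realType) (X : normedModType K)
    (f : {linear X -> K}) :
  continuous f <-> exists2 M, 0 < M & forall x, `|f x| <= M * `|x|.
Proof.
rewrite -linear_bounded_continuous; split.
  by move=> /linear_boundedP/pinfty_ex_gt0[M M0 hM]; exists M.
move=> [M M0 hM]; apply/linear_boundedP; near=> r => x.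
by apply: (le_trans (hM x)); rewrite ler_wpM2r//.
Unshelve. all: by end_near. Qed.

Section Sigma_facts.
Context (K : realType) (R Y H : hilbertType K) (T : configurable_triple R Y H).
Implicit Types (s t : Sigma T) (r q : R) (y z : Y).

Lemma SB_linear (k : K) r q : SB T (k *: r + q) = k *: SB T r + SB T q.
Proof. by apply: val_inj; rewrite /= linearP. Qed.

Lemma SY_linear (k : K) y z : SY T (k *: y + z) = k *: SY T y + SY T z.
Proof. by apply: val_inj; rewrite /= linearP. Qed.

HB.instance Definition _ := GRing.isLinear.Build K R (Sigma T) *:%R (SB T)
  SB_linear.
HB.instance Definition _ := GRing.isLinear.Build K Y (Sigma T) *:%R (SY T)
  SY_linear.

Lemma norm_SY_le y : `|SY T y| <= `|y|.
Proof.
have := @Sigma_norm_le _ _ _ _ T (SY T y) 0 y.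
by rewrite !linear0 add0r normr0 add0r; apply.
Qed.

Lemma Sigma_decomp s : exists r y, s = SB T r + SY T y.
Proof.
by have /asboolP[r [y e]] := valP s; exists r, y; apply: val_inj; rewrite /= -e.
Qed.

Lemma subspace_BR : subspace (@BR _ _ _ _ T).
Proof.
split; first by exists 0; rewrite ?linear0.
by move=> k _ _ [x _ <-] [y _ <-]; exists (k *: x + y); rewrite ?linearP.
Qed.

Lemma seq_complete_Sigma : Sigma_known T -> seq_complete (Sigma T).
Proof. by move=> [h _ _]; exact: cauchy_seq_complete. Qed.

(** Closedness of [BR] is given in [Sigma] but needed in [H]: the equivalence of the two norms on
    [BR] makes a sequence converging in [H] Cauchy in [Sigma], and carries its limit back. *)
Lemma closed_range_op : Sigma_known T -> closed (range (op T)).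
Proof.
move=> hS; have [_ cB [C1 [C2 [C10 C20 hC]]]] := hS.
move=> h /= hh.
have exr n : exists r, `|h - op T r| < n.+1%:R^-1.
  have e0 : 0 < n.+1%:R^-1 :> K by rewrite invr_gt0.
  have [_ [[r _ <-]]] := hh _ (nbhsx_ballx h _ e0).
  by rewrite -ball_normE /=; exists r.
have [u hu] := choice exr.
have uh : op T (u n) @[n --> \oo] --> h.
  apply/cvgrPdist_lt => e e0.
  near=> n; apply: (lt_trans (hu n)).
  by near: n; exact: (near_infty_natSinv_lt (PosNum e0)).
have [|s us] := seq_complete_Sigma hS (u := fun n => SB T (u n)).
  move=> e e0; have d0 : 0 < e / C2 / 2 by rewrite !divr_gt0.
  move/cvgrPdist_lt: uh => /(_ _ d0) [N _ hN]; exists N => m n Nm Nn.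
  rewrite -linearB; apply: (le_lt_trans (hC _).2).
  rewrite -ltr_pdivlMl// mulrC linearB.
  apply: (le_lt_trans (ler_distD h _ _)); rewrite (splitr (e / C2)).
  by apply: ltrD; [rewrite distrC|]; exact: hN.
have [r _ rs] : BR s.
  by apply: (closed_cvg (@BR _ _ _ _ T) cB _ _ us); apply: nearW => n; exists (u n).
exists r => //.
have ur : op T (u n) @[n --> \oo] --> op T r.
  apply/cvgrPdist_lt => e e0; have d0 : 0 < e / C1 by rewrite divr_gt0.
  move/cvgrPdist_lt: us => /(_ _ d0); apply: filterS => n.
  rewrite -rs -!linearB ltr_pdivlMr// mulrC => /(le_lt_trans _); apply.
  exact: (hC _).1.
by apply: (cvg_unique _ ur uh); exact: norm_hausdorff.
Unshelve. all: by end_near. Qed.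

Lemma SB_inj : injective (op T) -> injective (SB T).
Proof. by move=> oi r q /(congr1 val) /= /oi. Qed.

Lemma SB_bounded_below : Sigma_known T -> injective (op T) ->
  exists2 C, 0 < C & forall r, `|r| <= C * `|SB T r|.
Proof.
move=> hS oi; have [_ _ [C1 [C2 [C10 _ hC]]]] := hS.
have [C C0 h] := bounded_below (hdot_coercive H) (@hdotE _ H)
  (@op_closed _ _ _ _ T) oi (closed_range_op hS).
exists (C * C1) => [|r]; first exact: mulr_gt0.
by rewrite (le_trans (h r))// -mulrA ler_pM2l//; case: (hC r).
Qed.

Section projection.
Context (hS : Sigma_known T) (oi : injective (op T)).
Context (c : Sigma T -> Sigma T -> K) (hc : coercive_form setT c).

Let hcB : coercive_form (@BR _ _ _ _ T) c.
Proof. exact: coercive_subset hc. Qed.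

Lemma riesz_BR (f : {linear R -> K}) : continuous f ->
  exists r, forall q, c (SB T r) (SB T q) = f q.
Proof.
(* The functional is moved to [BR] through the inverse of [SB], which is bounded; [F] is read on
   [BR] only, where the chosen preimage is unique. *)
move=> /continuous_boundedP[M M0 bM].
have [C C0 hC] := SB_bounded_below hS oi.
pose F s := f (xget 0 [set r | SB T r = s]).
have FB r : F (SB T r) = f r.
  congr (f _); apply: (SB_inj oi).
  by apply: (@xgetPex _ 0 [set q | SB T q = SB T r]); exists r.
have [||_ [r _ <-] hr] := riesz_subspace hcB (F := F) (seq_complete_Sigma hS)
  subspace_BR (BR_closed hS).
- by move=> k _ _ [x _ <-] [y _ <-]; rewrite -linearP !FB linearP.
- exists (M * C) => _ [x _ <-]; rewrite FB (le_trans (bM x))// -mulrA.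
  by rewrite ler_pM2l.
by exists r => q; rewrite hr ?FB//; exists q.
Qed.

Lemma proj_BR s : exists r, forall q, c (SB T r) (SB T q) = c s (SB T q).
Proof.
have [||_ [r _ <-] hr] := riesz_subspace hcB (F := c s) (seq_complete_Sigma hS)
  subspace_BR (BR_closed hS).
- by move=> k x y _ _; rewrite (cfDr hc) (cfZr hc).
- have [M _ bM] := cf_bounded hc; by exists (M * `|s|).
by exists r => q; apply: hr; exists q.
Qed.

Lemma BR_perp_decomp s : exists r, perp c (@BR _ _ _ _ T) (s - SB T r).
Proof.
have [r hr] := proj_BR s; exists r => _ [q _ <-].
by rewrite (cfB hc) hr subrr.
Qed.

Lemma SB_unique r r' :
  (forall q, c (SB T r) (SB T q) = c (SB T r') (SB T q)) -> r = r'.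
Proof.
move=> h; apply: (SB_inj oi).
apply: (cf_unique hcB subspace_BR); [by exists r|by exists r'|].
by move=> _ [q _ <-].
Qed.

Lemma perp_BR_eq0 s : perp c (@BR _ _ _ _ T) s -> BR s -> s = 0.
Proof. by move=> ps Bs; apply: (cf_eq0 hc I); exact: ps. Qed.

End projection.
End Sigma_facts.

(** * The form [d]: inf-sup bound, kernels and represented functionals *)

Section InfSup.
Context (K : realType) (R Y H : hilbertType K) (T : configurable_triple R Y H).
Context (c d : Sigma T -> Sigma T -> K).
Implicit Types (s t : Sigma T).

Lemma propertyI_lower : propertyI c d ->
  exists2 a, 0 < a & forall t, perp c (@BR _ _ _ _ T) t -> t != 0 ->
    exists2 s, perp c (@BR _ _ _ _ T) s & a * (`|t| * `|s|) < d t s.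
Proof.
(* Halving [C] makes the inequality strict, so that a supremum possibly not attained yields an
   actual test vector. *)
move=> [_ _ [C C0 hC]]; exists (C / 2) => [|t pt t0]; first by rewrite divr_gt0.
have : ((C / 2)%:E < ereal_sup [set (d t s / (`|t| * `|s|))%:E
    | s in perp c (@BR _ _ _ _ T) `\ 0%R])%E.
  apply: (@lt_le_trans _ _ C%:E).
    by rewrite lte_fin ltr_pdivrMr// ltr_pMr// ltr1n.
  apply: (le_trans hC); apply: ereal_inf_lbound.
  by exists t => //; split => //; exact/eqP.
move=> /ereal_sup_gt[_ [s [ps /eqP s0] <-]]; rewrite lte_fin.
by rewrite ltr_pdivlMr ?mulr_gt0 ?normr_gt0//; exists s.
Qed.

Lemma propertyI_nondegenerate : propertyI c d ->
  forall t, perp c (@BR _ _ _ _ T) t ->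
    (forall s, perp c (@BR _ _ _ _ T) s -> d t s = 0) -> t = 0.
Proof.
move=> /propertyI_lower[a a0 ha] t pt ht.
have [//|t0] := eqVneq t 0.
have [s ps] := ha t pt t0; rewrite ht// => hs.
suff : 0 <= a * (`|t| * `|s|) by rewrite leNgt hs.
by rewrite mulr_ge0 ?mulr_ge0// ltW.
Qed.

End InfSup.

Section Kernel.
Context (K : realType) (R Y H : hilbertType K) (T : configurable_triple R Y H).
Context (hS : Sigma_known T) (oi : injective (op T)).
Context (c : Sigma T -> Sigma T -> K) (hc : coercive_form setT c).
Implicit Types (s t : Sigma T).

Local Notation BRT := (@BR _ _ _ _ T).

Section one_sided.
Context (d : Sigma T -> Sigma T -> K) (hd : propertyI c d).
Context (dB : forall s s' t, d (s - s') t = d s t - d s' t).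

(** Subtracting from [s] its projection on [BR] changes no value of [d], and the orthogonal
    remainder vanishes by nondegeneracy. Here [d] is a plain function, so that the transpose is
    covered too. *)
Lemma propertyI_kernel s : (forall t, d s t = 0) <-> BR s.
Proof.
split=> [ds|[r _ <-] t]; last exact: (propI_BR hd).
have [r pr] := BR_perp_decomp hS hc s.
exists r => //; apply/eqP; rewrite eq_sym -subr_eq0; apply/eqP.
apply: (propertyI_nondegenerate hd pr) => t _.
by rewrite dB ds (propI_BR hd) subrr.
Qed.

End one_sided.

Section two_sided.
Context (d : {bilinear Sigma T -> Sigma T -> K}).
Context (hd : propertyI c d) (hdT : propertyI c (fun s t => d t s)).

Lemma dBl s s' t : d (s - s') t = d s t - d s' t.
Proof. by rewrite linearBl. Qed.

Lemma dBr s s' t : d t (s - s') = d t s - d t s'.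
Proof. by rewrite linearBr. Qed.

Lemma d_kernel_l s : (forall t, d s t = 0) <-> BR s.
Proof. by apply: propertyI_kernel => //; exact: dBl. Qed.

Lemma d_kernel_r s : (forall t, d t s = 0) <-> BR s.
Proof.
by apply: (@propertyI_kernel (fun s t => d t s)) => // *; exact: dBr.
Qed.

Lemma d_bounded : exists2 M, 0 < M & forall s t, `|d s t| <= M * `|s| * `|t|.
Proof. exact: (bilinear_schwarz (propI_continuous hd)). Qed.

(** The inf-sup conditions solve the equation on the complement of [BR]; it extends to [Sigma]
    because [d xi] and [F] both vanish on [BR]. *)
Lemma d_represents (F : Sigma T -> K) :
  linear_on setT F -> bounded_on setT F -> (forall s, BR s -> F s = 0) ->
  exists2 xi, perp c BRT xi & forall s, d xi s = F s.
Proof.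
move=> lF [N bF] FB.
have [|||||||xi pxi hxi] := @infsup_surjective _ _ (perp c BRT) c d F
  (seq_complete_Sigma hS) hc (subspace_perp BRT hc) (closed_perp hc).
- by move=> k x y z; rewrite linearPl.
- by move=> k x y z; rewrite linearPr.
- exact: d_bounded.
- exact: propertyI_lower hd.
- move=> t pt ht; exact: (propertyI_nondegenerate hdT pt).
- by move=> k x y _ _; exact: lF.
- by exists N => x _; exact: bF.
exists xi => // s; have [r pr] := BR_perp_decomp hS hc s.
have := hxi _ pr; rewrite dBr (propI_BR hdT) subr0 => ->.
have := lF (-1) (SB T r) s I I; rewrite scaleN1r addrC => ->.
by rewrite FB ?mulr0 ?add0r//; exists r.
Qed.

(* A functional on [Y] that vanishes on [Y] inter [BR] extends to
   [Sigma = BR + Y] by [0] on [BR]. *)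
Lemma d_represents_SY (G : Y -> K) :
  (forall (k : K) y z, G (k *: y + z) = k * G y + G z) ->
  (exists2 N, 0 < N & forall z, `|G z| <= N * `|z|) ->
  (forall z, BR (SY T z) -> G z = 0) ->
  exists2 xi, perp c BRT xi & forall z, d xi (SY T z) = G z.
Proof.
move=> lG [N N0 bG] GB.
pose F s := G (xget 0 [set z | exists r, s = SB T r + SY T z]).
have GBl y z : G (y - z) = G y - G z.
  by rewrite addrC -scaleN1r lG mulN1r addrC.
have FE r z : F (SB T r + SY T z) = G z.
  have [r' e] : [set y | exists r', SB T r + SY T z = SB T r' + SY T y]
      (xget 0 [set y | exists r', SB T r + SY T z = SB T r' + SY T y]).
    by apply: xgetPex; exists z, r.
  (* Two [Y]-components of one vector differ by an element of [BR], where [G] vanishes, so the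
     choice made in [F] is immaterial. *)
  apply/eqP; rewrite -subr_eq0 /F -GBl; apply/eqP/GB; exists (r - r') => //.
  rewrite [SB T _]linearB [SY T _]linearB; apply/eqP.
  rewrite subr_eq addrAC eq_sym subr_eq addrC; apply/eqP.
  exact: esym e.
have [||s Bs|xi pxi hxi] := @d_represents F.
- move=> k s t _ _; have [r [y ->]] := Sigma_decomp s.
  have [q [z ->]] := Sigma_decomp t.
  by rewrite scalerDr addrACA -!linearP !FE lG.
(* Every decomposition gives [|F s| <= N * |y|]; the infimum over all of them bounds [F] by the norm
   of [Sigma]. *)
- exists N => s _; rewrite -ler_pdivrMl//; apply: le_Sigma_norm => r y e.
  have -> : s = SB T r + SY T y by apply: val_inj; rewrite /= e.
  by rewrite FE ler_pdivrMl// (le_trans (bG y))// ler_pM2l// lerDr.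
- case: Bs => r _ <-; have := FE r 0; rewrite linear0 addr0 => ->.
  by have := GBl 0 0; rewrite !subrr.
exists xi => // z; rewrite hxi; have := FE 0 z.
by rewrite linear0 add0r.
Qed.

End two_sided.
End Kernel.

(** * Decoupling *)

Section Decoupling.
Context (K : realType) (R Y H V : hilbertType K)
  (T : configurable_triple R Y H) (iV : {linear V -> R})
  (aR : {bilinear R -> R -> K}) (b : {bilinear R -> Y -> K})
  (aY : {bilinear Y -> Y -> K}).
Context (h0 : hypothesis0 T iV aR b aY) (hII : assumptionII T aR b).
Context (fR : {linear R -> K}) (hfR : continuous fR)
  (fY : {linear Y -> K}) (hfY : continuous fY).

Local Notation BRT := (@BR _ _ _ _ T).
Local Notation W v := (BY T (iV v)).

Let oi : injective (op T). Proof. by case: hII. Qed.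

(** On the range of [iV] the set behind [BY] is nonempty, so its default value [0] never
    interferes. *)
Lemma emb_BY v : emb T (W v) = op T (iV v).
Proof.
have [_ rV _] := h0_configurated h0.
have [y ey] : [set w | exists y, emb T y = op T w] (iV v).
  by rewrite -rV; exists v.
by apply: (@xgetPex _ 0 [set y | emb T y = op T (iV v)]); exists y.
Qed.

Lemma SY_BY v : SY T (W v) = SB T (iV v).
Proof. by apply: val_inj; exact: emb_BY. Qed.

Lemma SB_SY_lift r y : SB T r = SY T y -> exists2 v, iV v = r & W v = y.
Proof.
move=> /(congr1 val) /= e; have [_ rV _] := h0_configurated h0.
have [v _ vr] : range iV r by rewrite rV; exists y.
by exists v => //; apply: (@emb_inj _ _ _ _ T); rewrite emb_BY vr.
Qed.

Lemma BY_linear (k : K) u v : W (k *: u + v) = k *: W u + W v.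
Proof. by apply: (@emb_inj _ _ _ _ T); rewrite emb_BY [RHS]linearP !emb_BY !linearP. Qed.

Lemma aformE u v : aform T iV aR b aY u v = aY (W u) (W v).
Proof. by case: hII => _ ha hb; rewrite /aform ha !hb !add0r. Qed.

(** On [Y] the form [aY] is only semidefinite; pulled back to [V] it is the inner product
    [aform]. *)
Lemma aform_coercive : coercive_form setT (fun u v => aY (W u) (W v)).
Proof.
have [f fE hf] := h0_dot h0.
have -> : (fun u v => aY (W u) (W v)) = f.
  by apply/funext => u; apply/funext => v; rewrite fE aformE.
exact: dot_coercive.
Qed.

Lemma primal_unique_exists : exists! u : V, primal T iV aR b aY fR fY u.
Proof.
have ha := aform_coercive.
have [_ _ [C1 [C2 [C10 C20 hC]]]] := h0_configurated h0.
have /continuous_boundedP[MR MR0 bR] := hfR.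
have /continuous_boundedP[MY MY0 bY] := hfY.
have [||||u _ hu] := riesz_subspace ha (F := fun v => fR (iV v) + fY (W v))
  (@complete_seq_complete _ V).
- exact: subspaceT.
- exact: closedT.
- by move=> k x y _ _; rewrite BY_linear !linearP /= mulrDr addrACA.
- exists (MR * C2 + MY * C2) => v _; apply: (le_trans (ler_normD _ _)).
  rewrite mulrDl -!mulrA; apply: lerD.
    apply: (le_trans (bR _)); rewrite ler_pM2l//; apply: le_trans (hC v).2.
    by rewrite lerDl.
  apply: (le_trans (bY _)); rewrite ler_pM2l//; apply: le_trans (hC v).2.
  by rewrite lerDr.
exists u; split=> [v|u' hu']; first by rewrite aformE hu.
by apply: (cf_unique ha) => // v _; rewrite hu// -hu' aformE.
Qed.

Context (hS : Sigma_known T).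
Context (c : {dot (Sigma T) for @idfun K})
  (hc : norm_equiv (fun s : Sigma T => Num.sqrt (c s s)) (fun s => `|s|))
  (d : {bilinear (Sigma T) -> (Sigma T) -> K})
  (hd : propertyI c d) (hdT : propertyI c (fun s t => d t s)).

Let hcc : coercive_form setT c. Proof. exact: dot_coercive. Qed.

Let dBz s r : d s (SB T r) = 0. Proof. exact: (propI_BR hdT). Qed.

Let dzB r s : d (SB T r) s = 0. Proof. exact: (propI_BR hd). Qed.

Lemma problem_a_unique_exists : exists! r : R, problem_a c fR r.
Proof.
have [r hr] := riesz_BR hS oi hcc hfR; exists r; split => // r' hr'.
by apply: (SB_unique oi hcc) => q; rewrite hr hr'.
Qed.

Lemma problem_c_unique_exists y : exists! u : R, problem_c c y u.
Proof.
have [u hu] := proj_BR hS hcc (SY T y); exists u; split => // u' hu'.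
by apply: (SB_unique oi hcc) => q; rewrite hu hu'.
Qed.

Lemma problem_c_lift y u : BR (SY T y) -> problem_c c y u ->
  SB T u = SY T y.
Proof.
move=> [r _ ry] hu; rewrite -ry; congr (SB T _).
by apply: (SB_unique oi hcc) => q; rewrite hu ry.
Qed.

Lemma problem_b'_BR r y xi : problem_b' aY c d fY r y xi -> BR (SY T y).
Proof.
move=> hb; apply/(d_kernel_l hS hcc hd) => t.
by have [_ /eqP] := hb 0 t; rewrite oppr_eq0 => /eqP.
Qed.

Lemma problem_b'_exists r : problem_a c fR r ->
  exists y, exists2 xi, perp c BRT xi & problem_b' aY c d fY r y xi.
Proof.
move=> ha; have [u [hu _]] := primal_unique_exists.
have [[MY bY] _ _] := h0_aY h0.
have /continuous_boundedP[M M0 bM] := hfY.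
have [Mc Mc0 bMc] := cf_bounded hcc.
(* The residual of the first equation of (b') at [y = W u], which [d xi] has to match. *)
pose G z := aY (W u) z - fY z - c (SB T r) (SY T z).
have [|||xi pxi hxi] := d_represents_SY hS hcc hd hdT (G := G).
- move=> k y z; rewrite /G SY_linear (cfDr hcc) (cfZr hcc).
  have -> : aY (W u) (k *: y + z) = k * aY (W u) y + aY (W u) z.
    by rewrite linearPr.
  have -> : fY (k *: y + z) = k * fY y + fY z by rewrite linearP.
  by ring.
(* The absolute value is there because the bound [MY] carries no sign. *)
- exists (`|MY * `|W u| | + M + Mc * `|SB T r|) => [|z].
    by rewrite ltr_wpDr ?ltr_wpDl// mulr_ge0// ltW.
  rewrite !mulrDl (le_trans (ler_normB _ _))// lerD//; last first.
    by rewrite (le_trans (bMc _ _))// ler_wpM2l ?norm_SY_le// mulr_ge0// ltW.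
  rewrite (le_trans (ler_normB _ _))// lerD// (le_trans (bY _ _))//.
  by rewrite ler_wpM2r// ler_norm.
(* Such a [z] is [W w] for some [w] in [V]: the primal equation tested with [w], together with (a),
   cancels the residual. *)
- move=> z [q _ qz]; have [w wq wz] := SB_SY_lift qz.
  by have := hu w; rewrite aformE /G -wz SY_BY ha wq => ->; ring.
exists (W u), xi => // z t; split; first by rewrite hxi /G; ring.
by rewrite SY_BY dzB oppr0.
Qed.

(** Both [y] and [y'] lift to [V]. Test functions [W w] remove [d], and coercivity on [V] identifies
    the lifts; then [d (xi' - xi)] vanishes on [BR] and on [Y], hence on [Sigma]. *)
Lemma problem_b'_unique r y y' xi xi' :
  problem_b' aY c d fY r y xi -> problem_b' aY c d fY r y' xi' ->
  y' = y /\ BR (xi' - xi).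
Proof.
move=> hb hb'.
have [q _ qy] := problem_b'_BR hb; have [q' _ qy'] := problem_b'_BR hb'.
have [v _ vy] := SB_SY_lift qy; have [v' _ vy'] := SB_SY_lift qy'.
have ey : y' = y.
  rewrite -vy -vy'; congr (BY T (iV _)).
  apply: (cf_unique aform_coercive) => // w _.
  have [e _] := hb (W w) 0; have [e' _] := hb' (W w) 0.
  by move: e e'; rewrite SY_BY !dBz !subr0 -vy -vy' => -> ->.
split => //; apply/(d_kernel_l hS hcc hd) => t.
have [r' [z ->]] := Sigma_decomp t.
rewrite linearDr dBz add0r linearBl.
have [e _] := hb z 0; have [e' _] := hb' z 0.
by move: e'; rewrite ey -e => /addrI/oppr_inj ->; rewrite subrr.
Qed.

Lemma problem_b'_shift r y xi xi' : BR (xi' - xi) ->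
  problem_b' aY c d fY r y xi -> problem_b' aY c d fY r y xi'.
Proof.
move=> /(d_kernel_l hS hcc hd) h hb z t; have [e e'] := hb z t.
split => //; rewrite -e; congr (_ - _).
by apply/eqP; rewrite -subr_eq0 -linearBl h.
Qed.

(** Problem (b) is (b') with [xi] normalised to be orthogonal to [BR]; [p] is the multiplier of that
    constraint and comes out zero. *)
Lemma problem_bE r p y xi : problem_b aY c d fY r p y xi <->
  [/\ p = 0, perp c BRT xi & problem_b' aY c d fY r y xi].
Proof.
split=> [hb|[-> pxi hb'] q z t]; last first.
  have [e e'] := hb' z t; split => //; first by apply: pxi; exists q.
  by rewrite e' linear0 linear0r addr0.
have p0 : p = 0.
  apply: (SB_inj oi); rewrite linear0; apply: (cf_eq0 hcc I).
  by have [_ _] := hb 0 0 (SB T p); rewrite dBz oppr0 add0r.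
split => //; first by move=> _ [q _ <-]; case: (hb q 0 0).
move=> z t; have [e _ e'] := hb 0 z t; split => //.
by move: e'; rewrite p0 linear0 linear0r addr0.
Qed.

(** The first equation of (b') is tested with [z = W w]: the term in [d] drops out and (a) turns
    [c (Br, Bw)] into [fR (iV w)]. *)
Lemma problem_c_primal r y xi u : problem_a c fR r ->
  problem_b' aY c d fY r y xi -> problem_c c y u ->
  exists2 w : V, iV w = u & primal T iV aR b aY fR fY w.
Proof.
move=> ha hb' hu.
have [v vu vy] := SB_SY_lift (problem_c_lift (problem_b'_BR hb') hu).
exists v => // w; rewrite aformE vy.
have [e _] := hb' (W w) 0; move: e; rewrite SY_BY dBz subr0 ha => ->.
by rewrite addrC.
Qed.

(** The system has [d eta y] where (b) has [d y eta]. Membership of [y] in [BR] bridges the two, as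
    [BR] is the kernel of [d] on either side. *)
Lemma S5_decoupled p u y xi r :
  S5 aR b aY c d fR fY p u y xi r <->
  [/\ problem_a c fR r, problem_b aY c d fY r p y xi & problem_c c y u].
Proof.
have [_ aR0 b0] := hII.
split=> [h5|[ha hb hu] q v z t s].
  have p0 : p = 0.
    apply: (SB_inj oi); rewrite linear0; apply: (cf_eq0 hcc I).
    by have [_ _ _ + _] := h5 0 0 0 (SB T p) 0; rewrite dzB subr0.
  have [q _ qy] : BR (SY T y).
    apply/(d_kernel_r hS hcc hdT) => t; have [_ _ _ + _] := h5 0 0 0 t 0.
    by rewrite p0 linear0 linear0r sub0r => /eqP; rewrite oppr_eq0 => /eqP.
  split.
  - by move=> v; have [_ + _ _ _] := h5 0 v 0 0 0; rewrite aR0 b0 !add0r.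
  - apply/problem_bE; split => //.
      by move=> _ [q' _ <-]; case: (h5 q' 0 0 0 0).
    move=> z t; split; last by rewrite -qy dzB oppr0.
    have [_ _ + _ _] := h5 0 0 z 0 0.
    by rewrite b0 add0r => <-; ring.
  - move=> s; have [_ _ _ _ /eqP] := h5 0 0 0 0 s.
    by rewrite subr_eq0 (cf_sym hcc) (cf_sym hcc (SB T s)) => /eqP.
have /problem_bE[p0 pxi hb'] := hb.
have [q' _ qy] := problem_b'_BR hb'.
have [e e' _] := hb q z t; split => //.
- by rewrite aR0 b0 !add0r.
- by rewrite b0 add0r e; ring.
- by rewrite p0 linear0 linear0r -qy dBz subr0.
- by rewrite (cf_sym hcc) hu (cf_sym hcc) subrr.
Qed.

(** * Polar sets and the system (S4) *)

Lemma continuous_c t : continuous (c t).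
Proof.
have [M M0 bM] := cf_bounded hcc.
apply/continuous_boundedP; exists (M * `|t| + 1) => [|s].
  by rewrite ltr_wpDl// mulr_ge0// ltW.
by rewrite (le_trans (bM _ _))// mulrDl mul1r lerDl.
Qed.

(** The Riesz vector [rho] of [g] has no component orthogonal to [BR], because [g] vanishes on that
    component. *)
Lemma polar_perp_c (g : {linear Sigma T -> K}) : polar (perp c BRT) g ->
  exists r, g =1 c (SB T r).
Proof.
move=> [/continuous_boundedP[M _ bM] gp].
have [||||rho _ hrho] := riesz_subspace hcc (F := g) (seq_complete_Sigma hS).
- exact: subspaceT.
- exact: closedT.
- by move=> k x y _ _; rewrite linearP.
- by exists M.
have [r pr] := BR_perp_decomp hS hcc rho; exists r => s.
suff <- : rho = SB T r by rewrite hrho.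
apply/eqP; rewrite -subr_eq0; apply/eqP/(cf_eq0 hcc I).
rewrite {1}(cfB hcc) hrho// gp// sub0r (cf_sym hcc) pr ?oppr0//.
by exists r.
Qed.

Lemma polar_BR_d (g : {linear Sigma T -> K}) : polar BRT g ->
  exists2 xi, perp c BRT xi & g =1 d xi.
Proof.
move=> [/continuous_boundedP[M _ bM] gB].
have [|||xi pxi hxi] := d_represents hS hcc hd hdT (F := g).
- by move=> k x y _ _; rewrite linearP.
- by exists M.
- exact: gB.
by exists xi => // s; rewrite hxi.
Qed.

Lemma S4_decoupled u y (g0 gp : {linear Sigma T -> K}) :
  S4 aR b aY c fR fY u y g0 gp <->
  exists r xi, [/\ problem_a c fR r, problem_b' aY c d fY r y xi,
    problem_c c y u, g0 =1 d xi & gp =1 c (SB T r)].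
Proof.
have [_ aR0 b0] := hII.
(* [c 0] serves as the zero test functional. *)
have polar0B : polar BRT (c 0).
  by split=> [|s _]; [exact: continuous_c|exact: (cf0 hcc)].
have polar0p : polar (perp c BRT) (c 0).
  by split=> [|s _]; [exact: continuous_c|exact: (cf0 hcc)].
have polarp r : polar (perp c BRT) (c (SB T r)).
  split=> [|s ps]; first exact: continuous_c.
  by apply: (etrans (cf_sym hcc (SB T r) s)); apply: ps; exists r.
split=> [[pg0 pgp h4]|[r [xi [ha hb' hu eg0 egp]]]].
  have [r er] := polar_perp_c pgp; have [xi pxi exi] := polar_BR_d pg0.
  (* Tested with [l0 = c (y - Bq)], where [Bq] is the projection of [y] on [BR], the third equation
     becomes [c (y - Bq) (y - Bq) = 0]. *)
  have [q _ qy] : BR (SY T y).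
    have [q pq] := BR_perp_decomp hS hcc (SY T y); exists q => //.
    have polq : polar BRT (c (SY T y - SB T q)).
      by split; [exact: continuous_c|exact: pq].
    apply/eqP; rewrite eq_sym -subr_eq0; apply/eqP/(cf_eq0 hcc I).
    rewrite (cfBr hcc) (pq (SB T q)) ?subr0; last by exists q.
    by have [_ _ /eqP + _] := h4 0 0 _ _ polq polar0p; rewrite oppr_eq0 => /eqP.
  exists r, xi; split => //.
  - move=> v; have [+ _ _ _] := h4 v 0 _ _ polar0B polar0p.
    by rewrite aR0 b0 !add0r er.
  - move=> z t; split; last by rewrite -qy dzB oppr0.
    have [_ + _ _] := h4 0 z _ _ polar0B polar0p.
    by rewrite b0 add0r er exi => <-; ring.
  (* The functionals [c (SB T s)] lie in the polar of the complement and recover (c'). *)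
  - move=> s; have [_ _ _ /subr0_eq e] := h4 0 0 _ _ polar0B (polarp s).
    exact: etrans (cf_sym hcc _ _) (etrans e (cf_sym hcc _ _)).
have yB := problem_b'_BR hb'; have uy := problem_c_lift yB hu.
split.
- split; last by move=> _ [q _ <-]; rewrite eg0 dBz.
  have [M M0 bM] := d_bounded hd.
  apply/continuous_boundedP; exists (M * `|xi| + 1) => [|s].
    by rewrite ltr_wpDl// mulr_ge0// ltW.
  by rewrite eg0 (le_trans (bM _ _))// mulrDl mul1r lerDl.
- have [cr pr] := polarp r; split; last by move=> s ps; rewrite egp pr.
  by rewrite (_ : gp = c (SB T r) :> (_ -> _))//; exact/funext.
move=> v z l0 lp [_ pl0] [_ plp]; split.
- by rewrite aR0 b0 !add0r egp ha.
- have [e _] := hb' z 0; rewrite b0 add0r eg0 egp e; ring.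
- by rewrite pl0 ?oppr0.
- by rewrite uy subrr.
Qed.

End Decoupling.

(** As [d] does not see [BR], problem (b') fixes [xi] only modulo [BR]; its solutions are therefore
    described as a coset, whereas (b) has a single solution. *)
Theorem theorem7 (K : realType) (R Y H V : hilbertType K)
    (T : configurable_triple R Y H) (iV : {linear V -> R})
    (aR : {bilinear R -> R -> K}) (b : {bilinear R -> Y -> K})
    (aY : {bilinear Y -> Y -> K})
    (h0 : hypothesis0 T iV aR b aY) (hII : assumptionII T aR b)
    (hSigma : Sigma_known T)
    (c : {dot (Sigma T) for @idfun K})
    (hc : norm_equiv (fun s : Sigma T => Num.sqrt (c s s)) (fun s => `|s|))
    (d : {bilinear (Sigma T) -> (Sigma T) -> K})
    (hd : propertyI c d) (hdT : propertyI c (fun s t => d t s))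
    (fR : {linear R -> K}) (hfR : continuous fR)
    (fY : {linear Y -> K}) (hfY : continuous fY) :
  (exists! u : V, primal T iV aR b aY fR fY u) /\
  (* (1) *)
  [/\ exists! r : R, problem_a c fR r,
      forall r, problem_a c fR r ->
        exists! t : R * Y * Sigma T,
          problem_b aY c d fY r t.1.1 t.1.2 t.2,
      forall r p y xi, problem_a c fR r -> problem_b aY c d fY r p y xi ->
        exists! u : R, problem_c c y u,
      forall r p y xi u,
        problem_a c fR r -> problem_b aY c d fY r p y xi ->
        problem_c c y u ->
        exists2 w : V, iV w = u & primal T iV aR b aY fR fY w &
      forall p u y xi r,
        S5 aR b aY c d fR fY p u y xi r <->
        [/\ problem_a c fR r, problem_b aY c d fY r p y xi &
            problem_c c y u]] /\
  (* (2) *)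
  [/\ exists! r : R, problem_a c fR r,
      forall r, problem_a c fR r ->
        exists y xi, forall y' xi',
          problem_b' aY c d fY r y' xi' <-> y' = y /\ BR (xi' - xi),
      forall r y xi, problem_a c fR r -> problem_b' aY c d fY r y xi ->
        exists! u : R, problem_c c y u,
      forall r y xi u,
        problem_a c fR r -> problem_b' aY c d fY r y xi ->
        problem_c c y u ->
        exists2 w : V, iV w = u & primal T iV aR b aY fR fY w &
      forall u y (g0 gp : {linear Sigma T -> K}),
        S4 aR b aY c fR fY u y g0 gp <->
        exists r xi,
          [/\ problem_a c fR r, problem_b' aY c d fY r y xi,
              problem_c c y u, g0 =1 d xi & gp =1 c (SB T r)]].
Proof.
have hcc : coercive_form setT c by exact: dot_coercive.
split; first exact: (primal_unique_exists h0 hII).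
have exa := problem_a_unique_exists hII hfR hSigma hc.
have exc := problem_c_unique_exists hII hSigma hc.
have bE := problem_bE aY hII fY hc hdT.
split; split => //.
- move=> r ha; have [y [xi pxi hb']] :=
    problem_b'_exists h0 hII hfR hfY hSigma hc hd hdT ha.
  exists (0, y, xi); split=> [|[[p' y'] xi'] /= /bE].
    exact/bE.
  move=> [-> pxi' hb''].
  have [-> Bxi] := problem_b'_unique h0 hII hSigma hc hd hdT hb' hb''.
  congr (_, _); apply/esym/eqP; rewrite -subr_eq0; apply/eqP.
  (* The two candidates for [xi] differ by a vector both in [BR] and orthogonal to it. *)
  apply: (@perp_BR_eq0 _ _ _ _ T c hcc (xi' - xi)) => //.
  by apply: (subspaceB (subspace_perp (@BR _ _ _ _ T) hcc)).
- by move=> r p y xi u ha /bE[_ _ hb'];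
    exact: (problem_c_primal h0 hII hSigma hc hd hdT ha hb').
- by move=> p u y xi r; exact: (S5_decoupled aY hII).
- move=> r ha; have [y [xi pxi hb']] :=
    problem_b'_exists h0 hII hfR hfY hSigma hc hd hdT ha.
  exists y, xi => y' xi'; split=> [|[-> Bxi]].
    exact: (problem_b'_unique h0 hII hSigma hc hd hdT hb').
  exact: (problem_b'_shift hSigma hc hd Bxi hb').
- by move=> r y xi u; exact: (problem_c_primal h0 hII).
- by move=> u y g0 gp; exact: (S4_decoupled aY hII).
Qed.
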